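(* Let $\tilde{\mathcal G}=\tilde G_{(012)^\infty}$ be Grigorchuk's overgroup. Then for every $\epsilon>0$, $$\exp\left(\frac{n}{\log^{2+\epsilon}n}\right)\preceq\gamma_{\tilde{\mathcal G}}(n)\preceq\exp\left(\frac{n\log(\log n)}{\log n}\right).$$
   Context: Let $T_2$ be the infinite binary rooted tree whose vertices are the finite words over $\{0,1\}$ (the root is the empty word, the children of $v$ are $v0$ and $v1$). Let $P$ denote the action at a vertex $v$ that interchanges the two subtrees rooted at $v0$ and $v1$ (sending $v0w\mapsto v1w$ and $v1w\mapsto v0w$), and let $I$ denote the trivial action. A sequence $(a_n)_{n\ge1}$ with $a_n\in\{P,I\}$ is identified with the automorphism of $T_2$ that acts as $a_n$ at the vertex $1^{n-1}0$ for each $n\ge1$ and trivially at all other vertices. Let $a\in\mathrm{Aut}(T_2)$ act as $P$ at the root and trivially at all other vertices, and let $x$ be the automorphism given by the constant sequence $(P,P,P,\dots)$. For $\omega=\omega_1\omega_2\cdots\in\{0,1,2\}^{\mathbb N}$ let $b_\omega,c_\omega,d_\omega$ be the automorphisms given by the sequences $(b_n),(c_n),(d_n)$, where $b_n=I$ if $\omega_n=2$ and $b_n=P$ otherwise; $c_n=I$ if $\omega_n=1$ and $c_n=P$ otherwise; $d_n=I$ if $\omega_n=0$ and $d_n=P$ otherwise. $\tilde G_\omega$ is the subgroup of $\mathrm{Aut}(T_2)$ generated by $a,b_\omega,c_\omega,d_\omega,x$. The sequence $(012)^\infty$ is $012012012\cdots$. For a group $G$ with finite generating set $S$, $\gamma_{G,S}(n)$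 is the number of elements of $G$ that can be written as a product of at most $n$ generators from $S$; $\gamma_{\tilde{\mathcal G}}$ denotes this function for the generating set $\{a,b_\omega,c_\omega,d_\omega,x,xb_\omega,xc_\omega,xd_\omega\}$ with $\omega=(012)^\infty$ (the assertion does not depend on the choice of finite generating set). For functions $f,g$, $f\preceq g$ means that there are positive constants $A,B$ such that $f(n)\le A\,g(Bn)$ for all sufficiently large $n$; when $g$ is a volume growth function, $B$ is taken to be a positive integer. Here $\log^{2+\epsilon}n=(\log n)^{2+\epsilon}$. *)

(* Defs.v *)
From HB Require Import structures.
From mathcomp Require Export all_boot all_order all_algebra.
From mathcomp Require Import finmap.
From mathcomp Require Export all_classical all_reals all_analysis.

Set Implicit Arguments.
Unset Strict Implicit.
Unset Printing Implicit Defensive.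

Import Order.TTheory GRing.Theory Num.Theory.
Local Open Scope classical_set_scope.

(* Vertices of T_2: finite words over {0,1}, with 0 = false and 1 = true.
   The root is [::] and the children of v are rcons v false, rcons v true. *)
Definition vertex := seq bool.

Definition child (v u : vertex) : Prop := exists y : bool, u = rcons v y.

Definition is_tree_aut (f : vertex -> vertex) : Prop :=
  [/\ bijective f, f [::] = [::] &
      forall v u, child v u <-> child (f v) (f u)].

Record tree_aut := TreeAut {
  aut_fun :> vertex -> vertex;
  aut_funP : is_tree_aut aut_fun }.

HB.instance Definition _ := gen_eqMixin tree_aut.
HB.instance Definition _ := gen_choiceMixin tree_aut.

Lemma tree_aut_eqP (f g : tree_aut) : (f : vertex -> vertex) =1 g -> f = g.
Proof.
case: f g => [f fP] [g gP] /= /funext fg; rewrite -{g}fg in gP *.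
by rewrite (Prop_irrelevance fP gP).
Qed.

Lemma is_tree_aut_id : is_tree_aut id.
Proof. by split=> //; exists id. Qed.

Lemma is_tree_aut_comp f g :
  is_tree_aut f -> is_tree_aut g -> is_tree_aut (f \o g).
Proof.
move=> [fb f0 fc] [gb g0 gc]; split; first exact: bij_comp.
  by rewrite /= g0.
by move=> v u /=; rewrite gc fc.
Qed.

Lemma tree_aut_inv_ex (f : tree_aut) :
  exists g, [/\ is_tree_aut g, cancel f g & cancel g f].
Proof.
case: f => f [[g fK gK] f0 fc] /=; exists g; split=> //; split.
- by exists f.
- by rewrite -[X in g X]f0 fK.
- by move=> v u; rewrite (fc (g v)) !gK.
Qed.

Definition aut_one : tree_aut := TreeAut is_tree_aut_id.
Definition aut_mul (f g : tree_aut) : tree_aut :=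
  TreeAut (is_tree_aut_comp (aut_funP f) (aut_funP g)).
Definition aut_inv (f : tree_aut) : tree_aut :=
  let g := cid (tree_aut_inv_ex f) in
  TreeAut (let: And3 gP _ _ := projT2 g in gP).

Lemma aut_mulA : associative aut_mul.
Proof. by move=> f g h; apply: tree_aut_eqP. Qed.
Lemma aut_mul1 : left_id aut_one aut_mul.
Proof. by move=> f; apply: tree_aut_eqP. Qed.
Lemma aut_mulr1 : right_id aut_one aut_mul.
Proof. by move=> f; apply: tree_aut_eqP. Qed.
Lemma aut_mulV : left_inverse aut_one aut_inv aut_mul.
Proof.
move=> f; apply: tree_aut_eqP => v; rewrite /aut_inv /=.
by case: cid => g /= [_ fK _]; rewrite fK.
Qed.
Lemma aut_mulrV : right_inverse aut_one aut_inv aut_mul.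
Proof.
move=> f; apply: tree_aut_eqP => v; rewrite /aut_inv /=.
by case: cid => g /= [_ _ gK]; rewrite gK.
Qed.

(* The group Aut(T_2), acting on the left: (f * g) v = f (g v). *)
HB.instance Definition _ := isGroup.Build tree_aut
  aut_mulA aut_mul1 aut_mulr1 aut_mulV aut_mulrV.

(* Labels at vertices: true stands for P, false for I. [portrait p] is the
   automorphism acting at every vertex v as p v; see portrait_fun_rcons. *)
Fixpoint portrait_fun (p : vertex -> bool) (v : vertex) : vertex :=
  if v is y :: w then
    (y (+) p [::]) :: portrait_fun (fun u => p (y :: u)) w
  else [::].

Fixpoint portrait_inv (p : vertex -> bool) (v : vertex) : vertex :=
  if v is y :: w then
    let z := y (+) p [::] in z :: portrait_inv (fun u => p (z :: u)) w
  else [::].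

Lemma portrait_fun_rcons p v y :
  portrait_fun p (rcons v y) = rcons (portrait_fun p v) (y (+) p v).
Proof. by elim: v p => [|z v IHv] p //=; rewrite IHv. Qed.

Lemma portrait_funK p : cancel (portrait_fun p) (portrait_inv p).
Proof. by move=> v; elim: v p => [|y v IHv] p //=; rewrite addbK IHv. Qed.

Lemma portrait_invK p : cancel (portrait_inv p) (portrait_fun p).
Proof. by move=> v; elim: v p => [|y v IHv] p //=; rewrite addbK IHv. Qed.

Lemma portrait_is_tree_aut p : is_tree_aut (portrait_fun p).
Proof.
split=> //; first by exists (portrait_inv p);
  [exact: portrait_funK | exact: portrait_invK].
move=> v u; split=> [[y ->]|[y]].
  by exists (y (+) p v); rewrite portrait_fun_rcons.
move=> /(congr1 (portrait_inv p)); rewrite portrait_funK => ->.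
exists (y (+) p v); apply: (can_inj (portrait_funK p)).
by rewrite portrait_invK portrait_fun_rcons addbK.
Qed.

Definition portrait (p : vertex -> bool) : tree_aut :=
  TreeAut (portrait_is_tree_aut p).

(* The sequence (s n)_{n >= 1} as an automorphism: it acts as s n at the vertex
   1^{n-1}0 (a word of length n) and trivially elsewhere. The value s 0 is
   irrelevant. *)
Definition seq_aut (s : nat -> bool) : tree_aut :=
  portrait (fun v => (v == rcons (nseq (size v).-1 true) false) && s (size v)).

Definition aut_a : tree_aut := portrait (fun v => v == [::]).
Definition aut_x : tree_aut := seq_aut (fun _ => true).

(* omega is indexed from 1: the value omega 0 is irrelevant. *)
Section Overgroup.
Variable omega : nat -> 'I_3.

Definition aut_b : tree_aut := seq_aut (fun n => omega n != 2 :> nat).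
Definition aut_c : tree_aut := seq_aut (fun n => omega n != 1 :> nat).
Definition aut_d : tree_aut := seq_aut (fun n => omega n != 0 :> nat).

End Overgroup.

Definition is_subgroup (G : groupType) (H : set G) : Prop :=
  H 1%g /\ forall g h, H g -> H h -> H (g / h)%g.

Definition generated (G : groupType) (S : set G) : set G :=
  smallest (@is_subgroup G) S.

Definition overgroup (omega : nat -> 'I_3) : set tree_aut :=
  generated [set aut_a; aut_b omega; aut_c omega; aut_d omega; aut_x].

Definition overgroup_gens (omega : nat -> 'I_3) : set tree_aut :=
  [set aut_a; aut_b omega; aut_c omega; aut_d omega; aut_x;
       (aut_x * aut_b omega)%g; (aut_x * aut_c omega)%g;
       (aut_x * aut_d omega)%g].

Lemma generated_subgroup (G : groupType) (S : set G) :
  is_subgroup (generated S).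
Proof.
split=> [H [[H1 _] _] //|g h Hg Hh H [HH SH]].
by apply: HH.2; [exact: (Hg H) | exact: (Hh H)].
Qed.

Lemma generated_overgroup_gens omega :
  generated (overgroup_gens omega) = overgroup omega.
Proof.
set S := (X in generated X).
have [oneO divO] := generated_subgroup [set aut_a; aut_b omega; aut_c omega;
  aut_d omega; aut_x].
have mulO g h : overgroup omega g -> overgroup omega h ->
    overgroup omega (g * h)%g.
  move=> Og Oh; rewrite -[h]invgK; apply: (divO) => //.
  by rewrite -div1g; apply: divO.
have O5 : [set aut_a; aut_b omega; aut_c omega; aut_d omega; aut_x]
    `<=` overgroup omega by move=> g Sg H [_]; apply.
have [xO Ob Oc Od] : [/\ overgroup omega aut_x, overgroup omega (aut_b omega),
    overgroup omega (aut_c omega) & overgroup omega (aut_d omega)].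
  by split; apply: O5; do ?[by right | left].
have SO : S `<=` overgroup omega.
  by move=> g [[[Sg|->]|->]|->]; [exact: O5 | exact: mulO..].
rewrite eqEsubset; split=> [g|g] gP H [HH SH]; apply: gP; split=> //.
  by move=> h Sh; apply: SO Sh _ _.
by move=> h Sh; apply: SH; do 3 left.
Qed.

Definition omega012 (n : nat) : 'I_3 := inord (n.-1 %% 3).

Definition ball (G : groupType) (S : set G) (n : nat) : set G :=
  [set g | exists w : seq G,
    [/\ (size w <= n)%N, forall s, s \in w -> S s & g = (\prod_(s <- w) s)%g]].

Lemma finite_ball (G : groupType) (S : set G) (n : nat) :
  finite_set S -> finite_set (ball S n).
Proof.
move=> Sfin; elim: n => [|n IHn].
  apply: (sub_finite_set _ (finite_set1 1%g)) => g [[|s w] [//= _ _ ->]].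
  by rewrite big_nil.
apply: (sub_finite_set _ (B := [set 1%g] `|`
    ((fun p : G * G => (p.1 * p.2)%g) @` (S `*` ball S n)))).
  move=> g [[|s w] [/= sz Sw ->]]; first by left; rewrite big_nil.
  right; exists (s, (\prod_(t <- w) t)%g); last by rewrite big_cons.
  split=> /=; first by apply: Sw; rewrite mem_head.
  by exists w; split=> // t tw; apply: Sw; rewrite in_cons tw orbT.
rewrite finite_setU; split; first exact: finite_set1.
exact/finite_image/finite_setX.
Qed.

(* gamma_{H,S}(n) for a subgroup H of G generated by S. Since fset_set of an
   infinite set is empty, this is meant for finite S; see finite_ball. *)
Definition growth (G : groupType) (H S : set G) (n : nat) : nat :=
  #|` fset_set (H `&` ball S n)|.

Definition gamma_overgroup : nat -> nat :=
  growth (overgroup omega012) (overgroup_gens omega012).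

(* The relation f =< g for g a function of a real variable, and for g a growth
   function, where the scaling constant B must be a positive integer. *)
Definition preceq (R : realType) (f : nat -> R) (g : R -> R) : Prop :=
  exists A B : R, [/\ (0 < A)%R, (0 < B)%R &
    \forall n \near \oo, (f n <= A * g (B * n%:R))%R].

Definition preceq_growth (R : realType) (f : nat -> R) (g : nat -> nat) : Prop :=
  exists (A : R) (B : nat), [/\ (0 < A)%R, (0 < B)%N &
    \forall n \near \oo, (f n <= A * (g (B * n)%N)%:R)%R].

(* Main.v *)
Require Import Defs.
From mathcomp Require Import finmap zify ring lra.
Import Order.TTheory GRing.Theory Num.Theory.

(** The letters 0, b, c, d, x, xb, xc, xd form a group (Z/2)^3, recorded by
    the values f_0, f_1, f_2 over a period; the generators are a and the seven
    nonzero letters s_f, and s_f = (a^{f_0}, s_{rot f}) in the wreath recursion.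

    Upper bound. A letter with f_0 = 0 makes its two neighbours merge in the
    section where it disappears. A letter other than x has a zero among three
    consecutive levels, so with suitable weights the total weight of the
    sections drops at each level by the number m of letters other than x, up to
    a bounded error per section. Hence at some level j <= (log_2 n) / 2 one
    has m <= C n / log n. The 2^j sections at this level are words of total
    length O(n) with at most C n / log n letters other than x, and there are
    exp (O (n log log n / log n)) of those.

    Lower bound. The orbit of 1^oo is identified with the integers, where a
    acts by q |-> 1 - q and s_f by q |-> - q or q according to f at the 2-adic
    valuation of q mod 3; thus a x is the translation by 1. In
    d^{b_0} t^{g_0} d^{b_1} t^{g_1} ... (first letter acting first, t = a x)
    the germ at 0 reveals b_0 unless the trajectory of 0 returns to 0.
    Choosing the gaps at dyadic scale k among M 2^k values, with M of the order
    of the number of scales, makes returns rare for most bit sequences, so N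
    bits give 2^{N/16} elements of length O (N log^2 N). *)

Set Implicit Arguments.
Unset Strict Implicit.
Unset Printing Implicit Defensive.

Local Open Scope nat_scope.

(** * The wreath recursion *)

Definition label := (bool * bool * bool)%type.
Definition label0 : label := (false, false, false).
Definition labelx : label := (true, true, true).

Definition label_add (f g : label) : label :=
  (f.1.1 (+) g.1.1, f.1.2 (+) g.1.2, f.2 (+) g.2).

Definition label_rot (f : label) : label := (f.1.2, f.2, f.1.1).

(** The default value of [nth] supplies the third coordinate. *)
Definition label_nth (f : label) (i : nat) : bool :=
  nth f.2 [:: f.1.1; f.1.2] (i %% 3).

Definition flip (v : vertex) : vertex :=
  if v is y :: w then ~~ y :: w else [::].

Fixpoint spine (f : label) (v : vertex) : vertex :=
  match v with
  | [::] => [::]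
  | true :: w => true :: spine (label_rot f) w
  | false :: w => false :: (if f.1.1 then flip w else w)
  end.

Lemma flipK : involutive flip.
Proof. by case=> //= y v; rewrite negbK. Qed.

Lemma spine0 : spine label0 =1 id.
Proof. by elim=> //= -[] v IH //; rewrite [label_rot _]/= IH. Qed.

Lemma spineD f g : spine (label_add f g) =1 spine f \o spine g.
Proof.
move=> v; elim: v f g => [|[] v IH] //= [[f0 f1] f2] [[g0 g1] g2] /=.
  by congr cons; exact: (IH (f1, f2, f0) (g1, g2, g0)).
by case: f0; case: g0 => //=; rewrite flipK.
Qed.

Lemma label_rot_nth f i : label_nth (label_rot f) i = label_nth f i.+1.
Proof.
case: f => [[f0 f1] f2]; rewrite /label_nth -[i.+1]addn1 -(modnDml i).
by have := ltn_pmod i (isT : 0 < 3); case: (i %% 3) => [|[|[|]]].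
Qed.

Lemma portrait_fun_eq p q : p =1 q -> portrait_fun p =1 portrait_fun q.
Proof.
move=> pq v; elim: v p q pq => //= y v IH p q pq; rewrite pq; congr cons.
by apply: IH => u; rewrite pq.
Qed.

Lemma portrait_fun_false : portrait_fun (fun=> false) =1 id.
Proof. by elim=> //= y v ->; rewrite addbF. Qed.

Lemma aut_aE : aut_a =1 flip.
Proof.
case=> //= y v; rewrite addbT; congr cons.
by rewrite -[RHS]portrait_fun_false; apply: portrait_fun_eq.
Qed.

(** The sequence starts at index 1, hence the shift. Below 1 it moves on by one term, which rotates
    the label; below 0 only its first term acts, at the root of that subtree. *)
Lemma seq_autE s f :
  (forall n, s n.+1 = label_nth f n) -> seq_aut s =1 spine f.
Proof.
move=> sf v; elim: v s f sf => // y v IH s f sf.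
rewrite /seq_aut /= addbF; case: y; congr cons.
  rewrite -(IH (fun n => s n.+1)) => [|n]; last by rewrite label_rot_nth.
  by apply: portrait_fun_eq; case.
have -> : f.1.1 = s 1 by rewrite sf; case: f {sf} => [[]].
case s1 : (s 1).
  rewrite -aut_aE; apply: portrait_fun_eq => u; case: u => [|z u].
    by rewrite /= s1.
  by [].
rewrite -[RHS]portrait_fun_false; apply: portrait_fun_eq => -[|z u].
  by rewrite /= s1.
by [].
Qed.

Lemma omega012E n : omega012 n.+1 = n %% 3 :> nat.
Proof. by rewrite inordK // ltn_mod. Qed.

Lemma mod3P n : [\/ n %% 3 = 0, n %% 3 = 1 | n %% 3 = 2].
Proof.
have := ltn_pmod n (isT : 0 < 3).
by case: (n %% 3) => [|[|[|]]] // _; [constructor 1|constructor 2|constructor 3].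
Qed.

Lemma aut_bE : aut_b omega012 =1 spine (true, true, false).
Proof.
apply: seq_autE => n; rewrite omega012E /label_nth.
by case: (mod3P n) => ->.
Qed.

Lemma aut_cE : aut_c omega012 =1 spine (true, false, true).
Proof.
apply: seq_autE => n; rewrite omega012E /label_nth.
by case: (mod3P n) => ->.
Qed.

Lemma aut_dE : aut_d omega012 =1 spine (false, true, true).
Proof.
apply: seq_autE => n; rewrite omega012E /label_nth.
by case: (mod3P n) => ->.
Qed.

Lemma aut_xE : aut_x =1 spine labelx.
Proof.
by apply: seq_autE => n; rewrite /label_nth; case: (mod3P n) => ->.
Qed.

Lemma aut_mulE (g h : tree_aut) v : (g * h)%g v = g (h v).
Proof. by []. Qed.

Lemma overgroup_gensE g : overgroup_gens omega012 g ->
  g =1 flip \/ exists f, g =1 spine f.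
Proof.
case=> [[[[[[[|]|]|]|]|]|]|]; move=> ->.
- by left; apply: aut_aE.
- by right; exists (true, true, false); apply: aut_bE.
- by right; exists (true, false, true); apply: aut_cE.
- by right; exists (false, true, true); apply: aut_dE.
- by right; exists labelx; apply: aut_xE.
- right; exists (label_add labelx (true, true, false)) => v.
  by rewrite aut_mulE aut_xE aut_bE spineD.
- right; exists (label_add labelx (true, false, true)) => v.
  by rewrite aut_mulE aut_xE aut_cE spineD.
- right; exists (label_add labelx (false, true, true)) => v.
  by rewrite aut_mulE aut_xE aut_dE spineD.
Qed.

(** * Words and their sections *)

(* The pair (h, [:: f1; ...; fk]) stands for s_h a s_f1 a ... a s_fk. *)
Definition word := (label * seq label)%type.

Definition word_tail (t : seq label) : vertex -> vertex :=
  foldr (fun f k => flip \o spine f \o k) id t.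

Definition word_eval (w : word) : vertex -> vertex :=
  spine w.1 \o word_tail w.2.

Definition word1 : word := (label0, [::]).

Definition push_spine (f : label) (w : word) : word := (label_add f w.1, w.2).

(** Left multiplication by a. If the head is trivial and an a follows, the two a's cancel; otherwise
    a new trivial head is put in front. *)
Definition push_flip (w : word) : word :=
  if (w.1 == label0) && (w.2 != [::]) then (head label0 w.2, behead w.2)
  else (label0, w.1 :: w.2).

Lemma word1_eval : word_eval word1 =1 id.
Proof. exact: spine0. Qed.

Lemma push_spine_eval f w :
  word_eval (push_spine f w) =1 spine f \o word_eval w.
Proof. by move=> v; rewrite /word_eval /= spineD. Qed.

Lemma push_flip_eval w : word_eval (push_flip w) =1 flip \o word_eval w.
Proof.
case: w => h [|f t] v; rewrite /push_flip /word_eval /= ?andbF ?andbT /=.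
  by rewrite spine0.
by case: eqVneq => [->|_] /=; rewrite !spine0 ?flipK.
Qed.

(** A trivial letter between two a's would let them cancel. The last letter may be trivial, since a
    word may end in a. *)
Fixpoint reduced_tail (t : seq label) : bool :=
  if t is f :: t' then ((t' == [::]) || (f != label0)) && reduced_tail t'
  else true.

Lemma push_flip_reduced w :
  reduced_tail w.2 -> reduced_tail (push_flip w).2.
Proof.
case: w => h [|f t]; rewrite /push_flip /= ?andbF ?andbT //=.
by case: (eqVneq h) => [_ /andP[]|hn] //=; rewrite hn.
Qed.

(* A letter other than 0 and x is charged its distance to its first trivial
   coordinate, the level at which it makes two neighbouring letters merge. *)
Definition weight (f : label) : nat :=
  if f == label0 then 0 else
  if f == labelx then 5 else
  if ~~ f.1.1 then 5 else if ~~ f.1.2 then 6 else 7.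

Definition irregular (f : label) : bool := (f != label0) && (f != labelx).

Definition word_weight (w : word) : nat := weight w.1 + sumn (map weight w.2).
Definition word_irreg (w : word) : nat := irregular w.1 + count irregular w.2.

Lemma weight_add f g : weight (label_add f g) <= weight f + weight g.
Proof.
by case: f => [[[] []] []]; case: g => [[[] []] []].
Qed.

Lemma push_flip_weight w : word_weight (push_flip w) = word_weight w.
Proof.
case: w => h [|f t]; rewrite /push_flip /word_weight /= ?andbF ?andbT //=.
by case: eqVneq => [->|].
Qed.

Lemma push_spine_weight f w :
  word_weight (push_spine f w) <= weight f + word_weight w.
Proof. by rewrite /word_weight /= addnA leq_add2r weight_add. Qed.

(* The first component of the pair is the section that lies below 1 after the
   head letter has acted. *)
Definition push_sections (f : label) (s : word * word) : word * word :=
  (push_spine (label_rot f) s.2, if f.1.1 then push_flip s.1 else s.1).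

Arguments push_sections : simpl never.

Fixpoint sections_rec (h : label) (t : seq label) : word * word :=
  push_sections h (if t is f :: t' then sections_rec f t' else (word1, word1)).

Definition sections (w : word) : word * word := sections_rec w.1 w.2.

Definition word_parity (w : word) : bool := odd (size w.2).

Lemma push_sections_eval f s (y : bool) v :
  word_eval (if y then (push_sections f s).1 else (push_sections f s).2) v =
  if y then spine (label_rot f) (word_eval s.2 v)
  else if f.1.1 then flip (word_eval s.1 v) else word_eval s.1 v.
Proof.
case: y; first by rewrite push_spine_eval.
by rewrite /=; case: (f.1.1) => //; rewrite push_flip_eval.
Qed.

Lemma word_eval_cons h f t v :
  word_eval (h, f :: t) v = spine h (flip (word_eval (f, t) v)).
Proof. by []. Qed.

Lemma sections_eval w y v : word_eval w (y :: v) =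
  let z := y (+) word_parity w in
  z :: word_eval (if z then (sections w).1 else (sections w).2) v.
Proof.
case: w => h t; rewrite /sections /word_parity [_.1]/= [_.2]/=.
elim: t h => [|f t IH] h.
  rewrite addbF; cbv zeta.
  rewrite [sections_rec _ _]/= push_sections_eval !word1_eval.
  by rewrite /word_eval /=; case: y.
rewrite word_eval_cons IH; cbv zeta.
rewrite [sections_rec h _]/= push_sections_eval [size _]/= oddS addbN.
by case: (y (+) _).
Qed.

Lemma sections_reduced w :
  reduced_tail (sections w).1.2 && reduced_tail (sections w).2.2.
Proof.
case: w => h t; rewrite /sections /=; elim: t h => [|f t IH] h /=.
  by case: ifP.
have /andP[r1 r2] := IH f; rewrite r2 /=.
by case: ifP => // _; apply: push_flip_reduced.
Qed.

(** Every nontrivial head lends 3, to be repaid when it is closed. If f_0 = 1, rotation lowers the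
    weight of an irregular letter by 1 and keeps that of x, and the loan of the new head repays that
    of the head closed by a. If f_0 = 0, no head is closed and rotation adds at most 2, so that a
    new loan covers this and the gain of 1. A merger at a nontrivial head [h] saves enough weight to
    repay. *)
Lemma push_weight_ineq f h (u c : bool) : (~~ f.1.1 && u ==> c) ->
  weight (label_add (label_rot f) h) + 3 * (u + (h != label0)) + irregular f
  <= weight h + weight f + 3 * ((label_add (label_rot f) h != label0) + c).
Proof.
by case: f => [[[] []] []]; case: h => [[[] []] []]; case: u; case: c.
Qed.

Lemma push_sections_weight f s : let s' := push_sections f s in
  word_weight s'.1 + word_weight s'.2 + 3 * ((s.1.1 != label0) + (s.2.1 != label0))
    + irregular f
  <= word_weight s.1 + word_weight s.2 + weight f
     + 3 * ((s'.1.1 != label0) + (s'.2.1 != label0)).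
Proof.
case: s => [[g t] [h u]] /=.
have -> : word_weight (if f.1.1 then push_flip (g, t) else (g, t)) =
    word_weight (g, t) by case: ifP; rewrite ?push_flip_weight.
set c := _.1 != label0.
have : ~~ f.1.1 && (g != label0) ==> c.
  by rewrite /c; case: (f.1.1) => //=; case: eqP.
by move=> /push_weight_ineq -/(_ h); rewrite /word_weight /=; lia.
Qed.

Lemma sections_weight w :
  word_weight (sections w).1 + word_weight (sections w).2 + word_irreg w
    <= word_weight w + 6.
Proof.
case: w => h t; rewrite /sections /word_weight /word_irreg /=.
(* The loans on the two heads amount to at most 6. *)
suff: word_weight (sections_rec h t).1 + word_weight (sections_rec h t).2
    + irregular h + count irregular t <= weight h + sumn (map weight t)
    + 3 * (((sections_rec h t).1.1 != label0) + ((sections_rec h t).2.1 != label0)).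
  by rewrite -/(word_weight _) -/(word_weight _); lia.
elim: t h => [|f t IH] h.
  have := push_sections_weight h (word1, word1); cbv zeta.
  by rewrite -[push_sections _ _]/(sections_rec h [::]) /= muln0 !addn0 add0n.
have := push_sections_weight h (sections_rec f t); have := IH f.
rewrite [sections_rec h _]/=; cbv zeta.
move: (sections_rec f t) => s; move: (push_sections h s) => s' /=.
move: (s.1.1 != _) (s.2.1 != _) (s'.1.1 != _) (s'.2.1 != _) => a b c d; lia.
Qed.

Lemma reduced_tail_size t :
  reduced_tail t -> 5 * size t <= 5 + sumn (map weight t).
Proof.
elim: t => //= f t IH /andP[+ /IH]; case: eqVneq => [->|_] //=.
have : f != label0 -> 5 <= weight f by case: f => [[[] []] []].
by move=> H /H; lia.
Qed.

Lemma reduced_tail_zeros t :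
  reduced_tail t -> count (predC1 labelx) t <= (count irregular t).+1.
Proof.
elim: t => //= f t IH /andP[+ /IH]; case: eqVneq => [->|_] /=.
  by move=> _ _; case: (f != labelx); lia.
by rewrite /irregular => ->; lia.
Qed.

(** * Sparse words and the upper bound *)

Section Words.
Variable T : finType.
Implicit Types (s : seq T) (n : nat).

Fixpoint words n : seq (seq T) :=
  if n is n'.+1 then [seq x :: s | x <- enum T, s <- words n'] else [:: [::]].

Lemma mem_words n s : (s \in words n) = (size s == n).
Proof.
elim: n s => [|n IH] s; first by rewrite mem_seq1 size_eq0.
apply/allpairsP/eqP => [[[x s'] [_ /=]]|].
  by rewrite IH => /eqP <- ->.
case: s => // x s [sz]; exists (x, s).
by rewrite mem_enum IH sz eqxx.
Qed.

Lemma words_uniq n : uniq (words n).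
Proof.
elim: n => //= n IH; apply: allpairs_uniq => //; first exact: enum_uniq.
by move=> [x s] [y t] _ _ /= [-> ->].
Qed.

Lemma size_words n : size (words n) = #|T| ^ n.
Proof. by elim: n => //= n IH; rewrite size_allpairs IH -cardE expnS. Qed.

Lemma sum_words_cat m n (F : seq T -> nat) :
  \sum_(s <- words (m + n)) F s =
  \sum_(s <- words m) \sum_(t <- words n) F (s ++ t).
Proof.
elim: m F => [|m IH] F; first by rewrite big_seq1.
rewrite addSn [words _.+1]/= [words m.+1]/= !big_allpairs_dep /=.
by apply: eq_bigr => x _; rewrite IH.
Qed.

Lemma sum_words_prod n (F : T -> nat) :
  \sum_(s <- words n) \prod_(x <- s) F x = (\sum_x F x) ^ n.
Proof.
elim: n => [|n IH]; first by rewrite big_seq1 big_nil.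
rewrite [words _]/= big_allpairs_dep /= expnS -IH big_enum big_distrl /=.
apply: eq_bigr => x _; rewrite big_distrr /=.
by apply: eq_bigr => s _; rewrite big_cons.
Qed.

(** Give [d] the weight [K] and every other letter the weight 1. All words of length [n] together
    weigh (K + #|T| - 1)^n, and [K ^ R] times the weight of a sparse word is at least [K ^ n]. *)
Lemma count_sparse_words (d : T) K R n : 0 < K ->
  count (fun s => count (predC1 d) s <= R) (words n) * K ^ n
    <= K ^ R * (K + #|T|.-1) ^ n.
Proof.
move=> K0; pose F x := if x == d then K else 1.
have prodF s : \prod_(x <- s) F x * K ^ count (predC1 d) s = K ^ size s.
  elim: s => [|x s IH]; first by rewrite big_nil.
  rewrite big_cons /= expnS -IH /F.
  case: eqVneq => _; first by rewrite mulnA.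
  by rewrite mul1n expnS mulnCA.
have -> : K + #|T|.-1 = \sum_x F x.
  rewrite (bigD1 d) //= {1}/F eqxx; congr addn.
  rewrite (eq_bigr (fun=> 1)) => [|x /negPf nx]; last by rewrite /F nx.
  rewrite sum1_card cardC1 //.
rewrite -sum_words_prod -sum1_count big_distrl big_distrr /=.
rewrite [X in _ <= X](bigID (fun s => count (predC1 d) s <= R)) /=.
apply: leq_trans (leq_addr _ _).
rewrite big_seq_cond [X in _ <= X]big_seq_cond; apply: leq_sum => s.
rewrite mem_words => /andP[/eqP <- le]; rewrite mul1n -prodF mulnC.
by rewrite leq_mul2r leq_pexp2l // orbT.
Qed.

End Words.

(** Codes are given by a relation, so that an element may have several of them; only decoding has to
    be unique. *)
Lemma size_le_codes (T S : eqType) (s : seq T) (c : seq S) (P : T -> S -> Prop) :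
    uniq s -> (forall x, x \in s -> exists2 y, y \in c & P x y) ->
    (forall x x' y, P x y -> P x' y -> x = x') ->
  size s <= size c.
Proof.
move=> us ex inj; elim: s c us ex => //= x s IH c /andP[xs us] ex.
have [y yc Pxy] := ex x (mem_head _ _).
rewrite -(perm_size (_ : perm_eq (y :: rem y c) c)); last first.
  by rewrite perm_sym perm_to_rem.
rewrite /= ltnS; apply: IH us _ => z zs.
have [t tc Pzt] := ex z (mem_behead (s := x :: s) zs); exists t => //.
have ty : t != y.
  apply: contraNneq xs => tE; rewrite tE in Pzt.
  by rewrite -(inj _ _ _ Pzt Pxy).
have := perm_mem (perm_to_rem yc) t.
by rewrite tc inE (negPf ty) /= => <-.
Qed.

Lemma exists_le_average k (F : nat -> nat) S : 0 < k ->
  \sum_(i < k) F i <= S -> exists2 i, i < k & k * F i <= S.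
Proof.
move=> k0 le; have [/existsP[i Fi]|] := boolP [exists i : 'I_k, k * F i <= S].
  by exists i.
rewrite negb_exists => /forallP lt.
have : \sum_(i < k) S.+1 <= \sum_(i < k) k * F i.
  by apply: leq_sum => i _; rewrite ltnNge.
rewrite -big_distrr sum_nat_const card_ord leq_mul2l => /orP[/eqP k00|/(leq_trans)].
  by rewrite k00 in k0.
by move=> /(_ _ le); rewrite ltnn.
Qed.

(** * Sections at deeper levels *)

Lemma word_eval_nil w : word_eval w [::] = [::].
Proof.
rewrite /word_eval /=; suff -> : word_tail w.2 [::] = [::] by [].
by elim: (w.2) => //= f t ->.
Qed.

Fixpoint all_sections (ws : seq word) : seq word :=
  if ws is w :: ws' then
    [:: (sections w).1, (sections w).2 & all_sections ws'] else [::].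

Fixpoint parities (j : nat) (ws : seq word) : seq bool :=
  if j is j'.+1 then map word_parity ws ++ parities j' (all_sections ws)
  else [::].

Definition eval_all (v : vertex) (ws : seq word) : seq vertex :=
  [seq word_eval w v | w <- ws].

Lemma size_all_sections ws : size (all_sections ws) = 2 * size ws.
Proof. by elim: ws => //= w ws ->; lia. Qed.

Lemma all_sections_inj ws ws' : map word_parity ws = map word_parity ws' ->
  (forall v, eval_all v (all_sections ws) = eval_all v (all_sections ws')) ->
  forall v, eval_all v ws = eval_all v ws'.
Proof.
elim: ws ws' => [|w ws IH] [|w' ws'] //= [pw pws] e v; congr cons.
  case: v => [|y v]; first by rewrite !word_eval_nil.
  rewrite !sections_eval /= pw; congr cons.
  by have [e1 e2 _] := e v; case: (y (+) _).
by apply: IH pws _ _ => u; have [_ _] := e u.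
Qed.

(** A tree automorphism is determined by its sections at level [j] and the root actions of its
    sections at the levels before, which [parities] records. Equal sizes allow the concatenated
    parities to be split level by level. *)
Lemma levels_inj j ws ws' : size ws = size ws' ->
    parities j ws = parities j ws' ->
    iter j all_sections ws = iter j all_sections ws' ->
  forall v, eval_all v ws = eval_all v ws'.
Proof.
elim: j ws ws' => [|j IH] ws ws' sz /=; first by move=> _ ->.
rewrite -!iterS !iterSr => /eqP; rewrite eqseq_cat ?size_map //.
case/andP=> /eqP p1 /eqP p2 e.
by apply: all_sections_inj p1 _ => v; apply: IH; rewrite ?size_all_sections ?sz.
Qed.

Lemma size_levels j w : size (iter j all_sections [:: w]) = 2 ^ j.
Proof. by elim: j => //= j IH; rewrite size_all_sections IH expnS. Qed.

Lemma size_parities j ws : size (parities j ws) = (2 ^ j).-1 * size ws.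
Proof.
elim: j ws => //= j IH ws.
rewrite size_cat size_map IH size_all_sections expnS.
by have := expn_gt0 2 j => /= h; nia.
Qed.

Definition total_weight ws := sumn (map word_weight ws).
Definition total_irreg ws := sumn (map word_irreg ws).
Definition all_reduced (ws : seq word) := all (fun w => reduced_tail w.2) ws.

Lemma all_sections_weight ws :
  total_weight (all_sections ws) + total_irreg ws
    <= total_weight ws + 6 * size ws.
Proof.
rewrite /total_weight /total_irreg; elim: ws => //= w ws IH.
by have := sections_weight w; lia.
Qed.

Lemma all_sections_reduced ws : all_reduced (all_sections ws).
Proof. by elim: ws => //= w ws ->; rewrite andbT sections_reduced. Qed.

(** The error is 6 per word, and 6 (1 + 2 + ... + 2^(j-1)) = 6 * 2^j - 6. *)
Lemma levels_weight w j :
  total_weight (iter j all_sections [:: w])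
    + \sum_(i < j) total_irreg (iter i all_sections [:: w]) + 6
  <= word_weight w + 6 * 2 ^ j.
Proof.
elim: j => [|j IH]; first by rewrite big_ord0 /total_weight /=; lia.
rewrite big_ord_recr /= expnS.
have := all_sections_weight (iter j all_sections [:: w]).
rewrite size_levels; move: IH; set a := \sum_(i < j) _.
move: a (total_weight (all_sections _)) (total_weight _) (total_irreg _) (2 ^ j).
by move=> a b c d e; lia.
Qed.

Lemma sparse_level w k : 0 < k -> exists2 j, j < k &
  k * total_irreg (iter j all_sections [:: w]) <= word_weight w + 6 * 2 ^ k.
Proof.
move=> k0; apply: (exists_le_average k0 (F := fun j => total_irreg _)).
by apply: leq_trans (levels_weight w k); rewrite -addnA addnCA leq_addr.
Qed.

Lemma reduced_totals ws : all_reduced ws ->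
  5 * sumn [seq size w.2 | w <- ws] <= total_weight ws + 5 * size ws /\
  sumn [seq count (predC1 labelx) w.2 | w <- ws] <= total_irreg ws + size ws.
Proof.
rewrite /total_weight /total_irreg.
elim: ws => //= -[h t] ws IH /= /andP[rt /IH[]]; clear IH.
move: (sumn _) (sumn _) (sumn _) (sumn _) => a b c d le1 le2.
have := reduced_tail_size rt; have := reduced_tail_zeros rt.
rewrite /word_weight /word_irreg /=.
by split; rewrite /=; lia.
Qed.

(* The flag marks head letters, so that a concatenation can be parsed. *)
Definition symbol := (bool * label)%type.
Definition symbol_default : symbol := (false, labelx).

Definition serialize (ws : seq word) : seq symbol :=
  flatten [seq (true, w.1) :: [seq (false, f) | f <- w.2] | w <- ws].

(** Reading goes from the right: the first component collects letters until the head they belong to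
    is met. *)
Definition parse (s : seq symbol) : seq label * seq word :=
  foldr (fun b acc => if b.1 then ([::], (b.2, acc.1) :: acc.2)
                      else (b.2 :: acc.1, acc.2)) ([::], [::]) s.

Lemma parse_serialize ws : parse (serialize ws) = ([::], ws).
Proof.
elim: ws => //= -[h t] ws IH.
rewrite /serialize /= -/(serialize ws).
suff -> : parse ([seq (false, f) | f <- t] ++ serialize ws) = (t, ws) by [].
by elim: t => //= f t; rewrite -/(parse _) => ->.
Qed.

Lemma size_serialize ws :
  size (serialize ws) = size ws + sumn [seq size w.2 | w <- ws].
Proof.
rewrite /serialize; elim: ws => //= w ws; rewrite size_cat size_map => ->.
by lia.
Qed.

Lemma count_serialize ws : count (predC1 symbol_default) (serialize ws) =
  size ws + sumn [seq count (predC1 labelx) w.2 | w <- ws].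
Proof.
rewrite /serialize; elim: ws => //= w ws; rewrite count_cat count_map => ->.
rewrite (eq_count (a2 := predC1 labelx)); first by lia.
by move=> f; rewrite /= /symbol_default xpair_eqE eqxx.
Qed.

Definition pad (T : Type) (x : T) n (s : seq T) := s ++ nseq (n - size s) x.

Lemma size_pad (T : Type) (x : T) n s : size s <= n -> size (pad x n s) = n.
Proof. by move=> le; rewrite size_cat size_nseq subnKC. Qed.

Lemma pad_inj (T : Type) (x : T) n s s' :
  size s = size s' -> pad x n s = pad x n s' -> s = s'.
Proof.
move=> sz /(congr1 (take (size s))).
by rewrite /pad take_size_cat // sz take_size_cat.
Qed.

(** A label weighs at most 7, and multiplication by a preserves the weight. *)
Lemma ball_word n g : ball (overgroup_gens omega012) n g ->
  exists w, [/\ reduced_tail w.2, word_weight w <= 7 * n & g =1 word_eval w].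
Proof.
case=> s [+ + ->] {g}; elim: s n => [|g s IH] n /= sz Ss.
  by exists word1; split=> // v; rewrite big_nil word1_eval.
case: n sz => // n sz.
have [|w [rw ww gw]] := IH n sz; first by move=> h hs; apply: Ss; rewrite inE hs orbT.
have weight7 f : weight f <= 7 by case: f => [[[] []] []].
have [gE|[f gE]] := overgroup_gensE (Ss g (mem_head _ _)).
  exists (push_flip w); rewrite push_flip_reduced // push_flip_weight.
  split=> // [|v]; first by lia.
  by rewrite big_cons aut_mulE gE gw push_flip_eval.
exists (push_spine f w); split=> // [|v].
  by apply: leq_trans (push_spine_weight f w) _; have := weight7 f; lia.
by rewrite big_cons aut_mulE gE gw push_spine_eval.
Qed.

Lemma overgroup_gens_finite : finite_set (overgroup_gens omega012).
Proof. by rewrite /overgroup_gens !finite_setU; do ![split]; exact: finite_set1. Qed.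

Lemma card_symbol : #|{: symbol}| = 16.
Proof. by rewrite !card_prod card_bool. Qed.

Lemma growth_upper n k : 0 < k -> k * 2 ^ k <= n ->
  gamma_overgroup n * k ^ (5 * n) <=
  k * 2 ^ 2 ^ k * (5 * n).+1 * (k ^ (15 * n %/ k) * (k + 15) ^ (5 * n)).
Proof.
(* Both constants come from the initial weight [7 * n] with [2 ^ k <= n] and [k * 2 ^ k <= n]: five
   times the text length is at most 7 n + 16 n, and [k] times the number of symbols other than the
   default is at most 7 n + 6 n + 2 n. *)
move=> k0 kn; set L := 5 * n; set R := 15 * n %/ k.
pose sparse := [seq s <- words symbol L | count (predC1 symbol_default) s <= R].
pose shapes := [seq (j, b) | j <- iota 0 k, b <- words bool (2 ^ k)].
pose texts := [seq (l, s) | l <- iota 0 L.+1, s <- sparse].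
pose codes := [seq (x, y) | x <- shapes, y <- texts].
(* A code holds the level, the root actions before it, and the text of the sections with its length.
   Padding gives all codes a common format; the level and the recorded length allow it to be
   removed. *)
pose P (g : tree_aut) c := exists w j, let ws := iter j all_sections [:: w] in
  [/\ g =1 word_eval w, 2 ^ j <= 2 ^ k, size (serialize ws) <= L &
    c = ((j, pad false (2 ^ k) (parities j [:: w])),
         (size (serialize ws), pad symbol_default L (serialize ws)))].
have Pinj g g' c : P g c -> P g' c -> g = g'.
  move=> [w [j [gw jk sz ->]]] [w' [j' [gw' jk' sz' [ej eb es et]]]].
  rewrite -{}ej in jk' es et eb sz' *.
  have ser := pad_inj es et.
  have := parse_serialize (iter j all_sections [:: w]).
  rewrite ser parse_serialize => -[wsE].
  have par : parities j [:: w] = parities j [:: w'].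
    by apply: (pad_inj _ eb); rewrite !size_parities.
  apply: tree_aut_eqP => v; rewrite gw gw'.
  by have [] := levels_inj (erefl : size [:: w] = size [:: w']) par (esym wsE) v.
have Pex g : ball (overgroup_gens omega012) n g -> exists2 c, c \in codes & P g c.
  case/ball_word => w [rw ww gw].
  have [j jk le] := sparse_level w k0.
  have jk2 : 2 ^ j <= 2 ^ k by rewrite leq_exp2l // ltnW.
  set ws := iter j all_sections [:: w] in le.
  have szws : size ws = 2 ^ j by apply: size_levels.
  have red : all_reduced ws.
    rewrite /ws; case: (j) => [|i]; first by rewrite /= rw.
    exact: all_sections_reduced.
  have [le1 le2] := reduced_totals red.
  have le3 := levels_weight w j; rewrite -/ws in le3.
  have k2n : 2 ^ k <= n by apply: leq_trans kn; rewrite leq_pmull.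
  have szL : size (serialize ws) <= L.
    by rewrite size_serialize szws /L; rewrite szws in le1; lia.
  have cR : count (predC1 symbol_default) (serialize ws) <= R.
    rewrite leq_divRL // count_serialize mulnC.
    apply: (@leq_trans (k * (2 * 2 ^ k + total_irreg ws))).
      by rewrite leq_mul2l; apply/orP; right; rewrite szws in le2 *; lia.
    by rewrite mulnDr mulnCA; lia.
  exists ((j, pad false (2 ^ k) (parities j [:: w])),
         (size (serialize ws), pad symbol_default L (serialize ws))); last first.
    by exists w, j.
  apply: allpairs_f; apply: allpairs_f.
  - by rewrite mem_iota.
  - rewrite mem_words size_pad // size_parities muln1.
    exact: leq_trans (leq_pred _) jk2.
  - by rewrite mem_iota add0n ltnS.
  rewrite mem_filter mem_words size_pad // eqxx andbT.
  rewrite count_cat [X in _ + X](_ : _ = 0) ?addn0 //.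
  by rewrite count_nseq.
have fin : finite_set (overgroup omega012 `&` ball (overgroup_gens omega012) n)%classic.
  apply: sub_finite_set (finite_ball n overgroup_gens_finite).
  by move=> g [].
have le : gamma_overgroup n <= size codes.
  apply: (size_le_codes (P := P)) Pinj; first exact: fset_uniq.
  by move=> g; rewrite in_fset_set // => /set_mem[_ /Pex].
apply: leq_trans (leq_mul le (leqnn _)) _.
rewrite !size_allpairs !size_iota size_words card_bool -!mulnA.
do 3 (apply: leq_mul => //).
have := count_sparse_words symbol_default R L k0.
by rewrite card_symbol size_filter.
Qed.

(** * The action on the integers *)

Section IntegerModel.
Local Open Scope ring_scope.

(** The first [n] letters of the point of the orbit of 1^oo attached to [q]. The integer 0 is 1^oo
    itself; 2 r lies below 1 and 1 - 2 r below 0, in both cases over the point of r. *)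
Fixpoint address (n : nat) (q : int) : vertex :=
  if n is n'.+1 then
    if (2 %| q)%Z then true :: address n' (q %/ 2)%Z
    else false :: address n' ((1 - q) %/ 2)%Z
  else [::].

(** At [q = 0] the valuation is read as 0, which is harmless because - 0 = 0. *)
Definition zspine (f : label) (q : int) : int :=
  if label_nth f (logn 2 `|q|%N) then - q else q.

Lemma address_even n r : address n.+1 (r * 2) = true :: address n r.
Proof. by rewrite /= dvdz_mull // mulzK. Qed.

Lemma address_odd n r : address n.+1 (1 - r * 2) = false :: address n r.
Proof.
rewrite /= subKr mulzK // ifF //.
by apply/negP => /dvdzP[k]; lia.
Qed.

Lemma int_parityP q : exists r : int, q = r * 2 \/ q = 1 - r * 2.
Proof.
case: (boolP (2 %| q)%Z) => [/dvdzP[r ->]|nq]; first by exists r; left.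
exists ((1 - q) %/ 2)%Z; right; have := divz_eq (1 - q) 2.
have := modz_ge0 (1 - q) (isT : (2 : int) != 0).
have := ltz_pmod (1 - q) (isT : 0 < (2 : int)).
case: (eqVneq ((1 - q) %% 2)%Z 1) => [e|ne]; last by lia.
move=> _ _; rewrite e => qE; case/negP: nq; apply/dvdzP.
by exists (- ((1 - q) %/ 2)%Z); lia.
Qed.

Lemma address_flip n q : address n (1 - q) = flip (address n q).
Proof.
case: n => // n; case: (int_parityP q) => r [->|->].
  by rewrite address_even address_odd.
by rewrite subKr address_even address_odd.
Qed.

Lemma zspine_x q : zspine labelx q = - q.
Proof.
by rewrite /zspine /label_nth; case: (mod3P (logn 2 `|q|)) => ->.
Qed.

Lemma zspine_even f r : zspine f (r * 2) = zspine (label_rot f) r * 2.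
Proof.
have [->|r0] := eqVneq r 0.
  by rewrite /zspine mul0r oppr0 !if_same mul0r.
rewrite /zspine label_rot_nth abszM lognM ?absz_gt0 // addn1.
by case: ifP; rewrite // mulNr.
Qed.

Lemma zspine_odd f r :
  zspine f (1 - r * 2) = 1 - (if f.1.1 then 1 - r else r) * 2.
Proof.
rewrite /zspine (_ : logn 2 _ = 0%N); last first.
  rewrite lognE /=; case: ifP => // /andP[_ /dvdnP[k]]; lia.
rewrite /label_nth; case: f => [[[] f1] f2] /=; ring.
Qed.

Lemma address_spine n f q : address n (zspine f q) = spine f (address n q).
Proof.
elim: n f q => // n IH f q; case: (int_parityP q) => r [->|->].
  by rewrite zspine_even !address_even IH.
rewrite zspine_odd !address_odd /=.
by case: (f.1.1) => //; rewrite address_flip.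
Qed.

Lemma address_inj_mod n p q :
  address n p = address n q -> exists c : int, p - q = c * (2 ^ n)%N%:Z.
Proof.
elim: n p q => [|n IH] p q; first by exists (p - q); rewrite mulr1.
case: (int_parityP p) => r [->|->]; case: (int_parityP q) => s [->|->];
  rewrite ?address_even ?address_odd // => -[/IH[c rs]].
  by exists c; rewrite expnS PoszM -mulrBl rs; ring.
by exists (- c); rewrite expnS PoszM; lia.
Qed.

Lemma address_inj p q : (forall n, address n p = address n q) -> p = q.
Proof.
(* Addresses of length n = |p - q| determine integers modulo 2^n, and 2^n > n. *)
move=> /(_ `|p - q|%N) /address_inj_mod[c cE]; apply/eqP; rewrite -subr_eq0.
apply: contraT => pq; have c0 : (0 < `|c|)%N.
  by rewrite absz_gt0; apply: contra_neq pq => c0; rewrite cE c0 mul0r.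
have := congr1 absz cE; rewrite abszM absz_nat => e.
have := ltn_expl `|p - q|%N (isT : 1 < 2)%N.
by rewrite ltnNge {2}e leq_pmull.
Qed.

(** * Runs of d and translations, and the bits they reveal *)

Definition labeld : label := (false, true, true).

Definition dstep (b : bool) (q : int) : int := if b then zspine labeld q else q.

Lemma dstep0 b : dstep b 0 = 0.
Proof. by case: b; rewrite /dstep /zspine ?oppr0 ?if_same. Qed.

Lemma dstepK b : involutive (dstep b).
Proof.
case: b => // q; rewrite /= /zspine.
by case h: (label_nth labeld (logn 2 `|q|)); rewrite ?abszN h ?opprK.
Qed.

(* [run bs gs] is d^b0, then translation by g0, then d^b1, and so on: the
   lists interleave, with one more bit than gaps. *)
Fixpoint run (bs : seq bool) (gs : seq nat) (q : int) : int :=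
  match bs, gs with
  | [::], _ => q
  | b :: _, [::] => dstep b q
  | b :: bs', g :: gs' => run bs' gs' (dstep b q + g%:Z)
  end.

(** The positions just before each power of d; the end of the run is not listed. *)
Fixpoint orbit_of (bs : seq bool) (gs : seq nat) (q : int) : seq int :=
  match bs, gs with
  | [::], _ => [::]
  | b :: _, [::] => [:: q]
  | b :: bs', g :: gs' => q :: orbit_of bs' gs' (dstep b q + g%:Z)
  end.

Definition visits0 bs gs q : nat := count (pred1 (0 : int)) (orbit_of bs gs q).

(** For each time, the final position of the point that is at 0 at that time. This uses that d fixes
    0. *)
Fixpoint ends (bs : seq bool) (gs : seq nat) : seq int :=
  match bs, gs with
  | [::], _ => [::]
  | b :: _, [::] => [:: 0]
  | b :: bs', g :: gs' => run bs' gs' g%:Z :: ends bs' gs'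
  end.

(** This counts the pairs of times i < j for which the point at 0 at time i is again at 0 at time
    j. *)
Fixpoint collisions (bs : seq bool) (gs : seq nat) : nat :=
  match bs, gs with
  | b :: bs', g :: gs' => (visits0 bs' gs' g%:Z + collisions bs' gs')%N
  | _, _ => 0
  end.

(** A bit is recorded only at a time from which 0 returns to 0; the other bits can be read off the
    run. *)
Fixpoint advice (bs : seq bool) (gs : seq nat) : seq (option bool) :=
  match bs, gs with
  | [::], _ => [::]
  | b :: _, [::] => [:: None]
  | b :: bs', g :: gs' =>
    (if 0 \in orbit_of bs' gs' g%:Z then Some b else None) :: advice bs' gs'
  end.

Lemma visits0_cat bs1 bs2 gs1 gs2 (u : nat) q : size bs1 = (size gs1).+1 ->
  visits0 (bs1 ++ bs2) (gs1 ++ u :: gs2) q =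
  (visits0 bs1 gs1 q + visits0 bs2 gs2 (run bs1 gs1 q + u%:Z))%N.
Proof.
rewrite /visits0; elim: gs1 bs1 q => [|g gs1 IH] [|b bs1] q //= [sz].
  by case: bs1 sz => //= _; rewrite addn0.
by rewrite IH // addnA.
Qed.

(** The two times lie both in the left block, both in the right one, or one in each; in the last
    case the point enters the right block from an entry of [ends], shifted by the middle gap. *)
Lemma collisions_cat bs1 bs2 gs1 gs2 (u : nat) : size bs1 = (size gs1).+1 ->
  collisions (bs1 ++ bs2) (gs1 ++ u :: gs2) =
  (collisions bs1 gs1 + collisions bs2 gs2 +
   \sum_(p <- ends bs1 gs1) visits0 bs2 gs2 (p + u%:Z)%R)%N.
Proof.
elim: gs1 bs1 => [|g gs1 IH] [|b bs1] //= [sz].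
  by case: bs1 sz => //= _; rewrite big_seq1 add0r add0n addnC.
by rewrite IH // visits0_cat // big_cons; lia.
Qed.

Lemma size_ends bs gs : size bs = (size gs).+1 -> size (ends bs gs) = size bs.
Proof.
by elim: gs bs => [|g gs IH] [|b bs] //= [sz]; rewrite IH.
Qed.

(** At each time the position depends injectively on the start, so at most one [u] is at 0 then. *)
Lemma sum_visits0 U bs gs (h : nat -> int) : injective h ->
  (\sum_(u < U) visits0 bs gs (h u) <= size bs)%N.
Proof.
rewrite /visits0; have one (h' : nat -> int) : injective h' ->
    (\sum_(u < U) (h' u == 0) <= 1)%N.
  move=> hI; case: (pickP (fun u : 'I_U => h' u == 0)) => [u0 hu0|no].
    rewrite (bigD1 u0) //= hu0 big1 // => u uu0.
    case: eqP => // e; case/eqP: uu0.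
    by apply/val_inj/hI; rewrite e; apply/esym/eqP.
  by rewrite big1 // => u _; rewrite no.
elim: bs gs h => [|b bs IH] gs h hI; first by rewrite big1.
case: gs => [|g gs] /=.
  by under eq_bigr do rewrite addn0; apply: leq_trans (one h hI) _.
rewrite big_split /= -add1n; apply: leq_add; first exact: one.
apply: (IH gs (fun u => dstep b (h u) + g%:Z)).
by move=> x y /addIr /(inv_inj (dstepK b)) /hI.
Qed.


(** The valuation of [p] is below [J], and adding a multiple of 2^J changes no divisibility by 2^n
    with n <= J. *)
Lemma logn2_add (p z : int) J : p != 0 -> (`|p| < 2 ^ J)%N ->
  ((2 ^ J)%N%:Z %| z)%Z -> logn 2 `|(p + z)%R|%N = logn 2 `|p|%N.
Proof.
move=> p0 pJ zJ; have absp : (0 < `|p|)%N by rewrite absz_gt0.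
have dvd n : (n <= J)%N -> (2 ^ n %| `|(p + z)%R|)%N = (2 ^ n %| `|p|)%N.
  move=> nJ; have zn : ((2 ^ n)%N%:Z %| z)%Z.
    by apply: dvdz_trans zJ; rewrite dvdzE /= dvdn_exp2l.
  by have := rpredDr p zn; rewrite !dvdzE /=.
have vJ : (logn 2 `|p| < J)%N.
  rewrite -(ltn_exp2l _ _ (isT : 1 < 2)%N); apply: leq_ltn_trans pJ.
  by rewrite dvdn_leq // pfactor_dvdn.
have pz : (0 < `|(p + z)%R|)%N.
  rewrite lt0n; apply/eqP => pz0; have := dvd J (leqnn J).
  by rewrite pz0 dvdn0 => /esym /(dvdn_leq absp); rewrite leqNgt pJ.
apply/eqP; rewrite eqn_leq leqNgt; apply/andP; split.
  apply/negP; rewrite -pfactor_dvdn // dvd //.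
  by rewrite pfactor_dvdn // ltnn.
by rewrite -pfactor_dvdn // (dvd _ (ltnW vJ)) pfactor_dvdn.
Qed.

Definition signed (e : bool) (z : int) : int := if e then - z else z.

Lemma dstep_affine b p J : p != 0 -> (`|p| < 2 ^ J)%N ->
  exists e, forall z, ((2 ^ J)%N%:Z %| z)%Z ->
    dstep b (p + z) = dstep b p + signed e z.
Proof.
move=> p0 pJ; case: b; last by exists false.
exists (label_nth labeld (logn 2 `|p|)) => z zJ.
by rewrite /= /zspine (logn2_add p0 pJ zJ) /signed; case: ifP; rewrite // opprD.
Qed.

Lemma abs_dstep b p : `|dstep b p|%N = `|p|%N.
Proof. by case: b => //=; rewrite /zspine; case: ifP; rewrite ?abszN. Qed.

(* Away from 0, each step is 2-adically locally an isometry of the form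
   z |-> c + z or z |-> c - z. *)
Lemma run_affine bs gs p J :
    visits0 bs gs p = 0%N -> (`|p| + sumn gs < 2 ^ J)%N ->
  exists e, forall z, ((2 ^ J)%N%:Z %| z)%Z ->
    run bs gs (p + z) = run bs gs p + signed e z.
Proof.
rewrite /visits0; elim: bs gs p => [|b bs IH] gs p; first by exists false.
case: gs => [|g gs] /= /eqP; rewrite addn_eq0 eqb0 => /andP[p0 /eqP vis] pJ.
  by apply: dstep_affine; rewrite // addn0 in pJ *.
have [|e run_e] := IH gs _ vis.
  by apply: leq_ltn_trans pJ; rewrite -(abs_dstep b p); lia.
have [|e' step_e'] := dstep_affine b p0 (J := J).
  by apply: leq_ltn_trans pJ; rewrite leq_addr.
exists (e (+) e') => z zJ; rewrite step_e' // addrAC run_e.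
  by congr (_ + _); rewrite /signed; case: e {run_e}; case: e' {step_e'}; rewrite ?opprK.
by rewrite /signed; case: (e'); rewrite ?rpredN.
Qed.

(* Without a return to 0, the germ of the run at 0 only sees the first bit:
   d fixes 2^J and negates 2^(J+1) when 3 divides J. *)
Lemma run_head_inj b b' bs bs' gs (g : nat) :
    visits0 bs gs g%:Z = 0%N -> visits0 bs' gs g%:Z = 0%N ->
    run (b :: bs) (g :: gs) =1 run (b' :: bs') (g :: gs) -> b = b'.
Proof.
(* A multiple of 3 for which 2^J exceeds every distance travelled. *)
move=> v v' eq_run; set J := (3 * (g + sumn gs))%N.
have gJ : (`|g%:Z| + sumn gs < 2 ^ J)%N.
  by apply: leq_ltn_trans (ltn_expl J (isT : 1 < 2)%N); rewrite /J; lia.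
have [e eE] := run_affine v gJ; have [e' e'E] := run_affine v' gJ.
have J3 i : ((J + i) %% 3 = i %% 3)%N by rewrite /J mulnC modnMDl.
have step0 c : dstep c (2 ^ J)%N%:Z = (2 ^ J)%N%:Z.
  case: c => //=; rewrite /zspine absz_nat pfactorK //.
  by rewrite /label_nth -[J]addn0 J3.
have step1 c : dstep c (2 ^ (J + 1))%N%:Z = signed c (2 ^ (J + 1))%N%:Z.
  case: c => //=; rewrite /zspine absz_nat pfactorK //.
  by rewrite /label_nth J3.
(* The values at 0 cancel the translation part; those at 2^J, which d fixes, give [e = e']; those at
   2^(J+1) then show the bit as a sign. *)
have := eq_run 0; have := eq_run (2 ^ J)%N%:Z; have := eq_run (2 ^ (J + 1))%N%:Z.
rewrite /= !dstep0 !step0 !step1 add0r.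
have J1 c : ((2 ^ J)%N%:Z %| signed c (2 ^ (J + 1))%N%:Z)%Z.
  by rewrite /signed; case: c; rewrite ?rpredN dvdzE /= dvdn_exp2l ?leq_addr.
rewrite ![_ + g%:Z]addrC !eE ?e'E // => + + r0; rewrite r0 => /addrI h1 /addrI h0.
have : (0 < 2 ^ J)%N by rewrite expn_gt0.
move: h1 h0; rewrite /signed addn1 expnS; case: (e); case: (e'); case: (b); case: (b') => //; lia.
Qed.

(** Bits are recovered from the first one on, by the advice or by the germ at 0, and each known step
    is cancelled before the next. *)
Lemma run_inj bs bs' gs : size bs = (size gs).+1 -> size bs' = (size gs).+1 ->
  advice bs gs = advice bs' gs -> run bs gs =1 run bs' gs -> bs = bs'.
Proof.
elim: gs bs bs' => [|g gs IH] [|b bs] [|b' bs'] // [sz] [sz'].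
  (* The last bit is read off at 2, which d negates. *)
  case: bs sz => // _; case: bs' sz' => // _ _ /(_ 2) /=.
  by case: b; case: b'.
move=> /= [hd tl] eq_run; have bE : b = b'.
  have nv cs : 0 \notin orbit_of cs gs g%:Z -> visits0 cs gs g%:Z = 0%N.
    by move=> /count_memPn.
  move: hd; case: ifP => [_|/negbT /nv v]; case: ifP => [_|/negbT /nv v'] //.
    by case.
  by move=> _; apply: run_head_inj v v' _.
rewrite -{}bE in eq_run *; congr cons; apply: IH => // q.
by have := eq_run (dstep b (q - g%:Z)); rewrite dstepK subrK.
Qed.

Lemma count_advice bs gs :
  (count (predC1 None) (advice bs gs) <= collisions bs gs)%N.
Proof.
elim: bs gs => [|b bs IH] [|g gs] //=; apply: leq_add (IH gs).
by case: ifP => //= h; rewrite -has_count has_pred1.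
Qed.

Lemma size_advice bs gs : size bs = (size gs).+1 -> size (advice bs gs) = size bs.
Proof.
by elim: gs bs => [|g gs IH] [|b bs] //= [sz]; rewrite IH.
Qed.

End IntegerModel.

(** * Choice of the gaps and the lower bound *)

Lemma sum_words_const (T : finType) n c :
  \sum_(s <- words T n) c = #|T| ^ n * c.
Proof. by rewrite big_const_seq count_predT size_words iter_addn_0 mulnC. Qed.

(* For fixed bits, each pair consisting of a start in the left block and a
   time in the right block collides for at most one value of the middle gap;
   hence a good middle gap exists at every scale. *)
Lemma gaps_exist M k : 0 < M -> exists gs, [/\ (size gs).+1 = 2 ^ k,
  sumn gs <= k * M * 2 ^ k &
  4 * M * (\sum_(bs <- words bool (2 ^ k)) collisions bs gs)
    <= k * 2 ^ k * 2 ^ 2 ^ k].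
Proof.
move=> M0; elim: k => [|k [gs [sz sum_gs coll]]].
  by exists [::]; split=> //; rewrite big1 ?muln0 // => -[|b []].
set m := 2 ^ k in sz sum_gs coll *; set U := M * (2 * m).
have szW b : b \in words bool m -> size b = (size gs).+1.
  by rewrite mem_words sz => /eqP.
pose cross u := \sum_(b1 <- words bool m) \sum_(b2 <- words bool m)
  \sum_(p <- ends b1 gs) visits0 b2 gs (p + u%:Z)%R.
have U0 : 0 < U by rewrite !muln_gt0 M0 expn_gt0.
have [u uU cross_u] : exists2 u, u < U &
    U * cross u <= 2 ^ m * (2 ^ m * (m * m)).
  apply: (exists_le_average U0); rewrite /cross exchange_big /=.
  rewrite -{1}[2]card_bool -sum_words_const big_seq [X in _ <= X]big_seq.
  apply: leq_sum => b1 /szW sz1; rewrite exchange_big /=.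
  rewrite -{1}[2]card_bool -sum_words_const big_seq [X in _ <= X]big_seq.
  apply: leq_sum => b2 /szW sz2; rewrite exchange_big /=.
  apply: (@leq_trans (\sum_(p <- ends b1 gs) m)); last first.
    by rewrite big_const_seq count_predT size_ends // sz1 sz iter_addn_0.
  apply: leq_sum => p _; rewrite -sz -sz2.
  apply: (sum_visits0 U b2 gs (h := fun u => p + u%:Z)%R).
  by move=> x y /addrI [].
(* The same gaps serve both halves, so collisions inside either half have the same average. *)
exists (gs ++ u :: gs); split.
- by rewrite size_cat /= expnS -/m; lia.
- rewrite sumn_cat /= expnS -/m.
  by rewrite /U in uU; nia.
rewrite expnS -/m mul2n -addnn sum_words_cat.
have -> : \sum_(b1 <- words bool m) \sum_(b2 <- words bool m)
    collisions (b1 ++ b2) (gs ++ u :: gs) =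
    2 * (2 ^ m * \sum_(b <- words bool m) collisions b gs) + cross u.
  have constE (F : nat) : \sum_(b <- words bool m) F = 2 ^ m * F.
    by rewrite sum_words_const card_bool.
  have left_sum : \sum_(b1 <- words bool m) \sum_(b2 <- words bool m)
      collisions b1 gs = 2 ^ m * \sum_(b <- words bool m) collisions b gs.
    by rewrite exchange_big constE.
  rewrite mul2n -addnn -[X in X + _ + _]left_sum -[X in _ + X + _]constE.
  rewrite -!big_split /=; apply: eq_big_seq => b1 /szW sz1.
  by rewrite -!big_split /=; apply: eq_bigr => b2 _; rewrite collisions_cat.
rewrite mulnDr; set C := \sum_(b <- _) _ in coll *.
have m0 : 0 < m by rewrite expn_gt0.
(* The bound on [U * cross u] divided by [m], as [U] is 2 M m; thus each scale adds the same
   proportion of collisions. *)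
have : 2 * M * cross u <= 2 ^ m * 2 ^ m * m.
  rewrite -(leq_pmul2r m0); apply: leq_trans (_ : _ <= U * cross u) _.
    by rewrite /U; apply: eq_leq; ring.
  by apply: leq_trans cross_u _; apply: eq_leq; ring.
rewrite expnD; move: (leq_mul (leqnn (2 * 2 ^ m)) coll).
move: (cross u) (2 ^ m) => c w; nia.
Qed.

(** * Runs as group elements, and the count of elements *)

Lemma ball_overgroup n :
  (ball (overgroup_gens omega012) n `<=` overgroup omega012)%classic.
Proof.
rewrite -generated_overgroup_gens => g [s [_ + ->]] {g}.
set H := generated _; have [H1 HV] : is_subgroup H := generated_subgroup _.
have HM x y : H x -> H y -> H (x * y)%g.
  by move=> Hx Hy; rewrite -[y]invgK; apply: (HV) => //; rewrite -div1g; apply: HV.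
elim: s => [|x s IH] Ss; first by rewrite big_nil.
rewrite big_cons; apply: HM.
  by move=> K [_]; apply; apply: Ss; rewrite mem_head.
by apply: IH => y ys; apply: Ss; rewrite inE ys orbT.
Qed.

Definition dstep_word (b : bool) : seq tree_aut :=
  if b then [:: aut_d omega012] else [::].

(* [a * x] translates the integer model by 1. *)
Fixpoint run_word (bs : seq bool) (gs : seq nat) : seq tree_aut :=
  match bs, gs with
  | [::], _ => [::]
  | b :: _, [::] => dstep_word b
  | b :: bs', g :: gs' =>
    run_word bs' gs' ++ flatten (nseq g [:: aut_a; aut_x]) ++ dstep_word b
  end.

Definition run_aut bs gs : tree_aut := (\prod_(s <- run_word bs gs) s)%g.

Lemma run_aut_address bs gs n q :
  run_aut bs gs (address n q) = address n (run bs gs q).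
Proof.
rewrite /run_aut; elim: bs gs q => [|b bs IH] gs q; first by rewrite big_nil.
have dE : (\prod_(s <- dstep_word b) s)%g (address n q) = address n (dstep b q).
  case: b; last by rewrite big_nil.
  by rewrite big_seq1 aut_dE /= address_spine.
case: gs => [|g gs] //=; rewrite !big_cat !aut_mulE /= dE.
have -> : (\prod_(s <- flatten (nseq g [:: aut_a; aut_x])) s)%g
    (address n (dstep b q)) = address n (dstep b q + g%:Z)%R; last exact: IH.
elim: g => [|g IHg]; first by rewrite big_nil addr0.
rewrite /= !big_cons !aut_mulE IHg aut_aE aut_xE -address_spine -address_flip.
by congr address; rewrite zspine_x; lia.
Qed.

Lemma run_aut_inj bs bs' gs : run_aut bs gs = run_aut bs' gs -> run bs gs =1 run bs' gs.
Proof. by move=> e q; apply: address_inj => n; rewrite -!run_aut_address e. Qed.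

Lemma run_word_size bs gs : size bs = (size gs).+1 ->
  size (run_word bs gs) <= size bs + 2 * sumn gs.
Proof.
have d1 b : size (dstep_word b) <= 1 by case: b.
elim: gs bs => [|g gs IH] [|b bs] //= [sz].
  by apply: leq_trans (d1 b) _.
rewrite !size_cat size_flatten /shape map_nseq sumn_nseq /=.
by have := IH bs sz; have := d1 b; lia.
Qed.

Lemma run_aut_ball bs gs n : size bs = (size gs).+1 ->
    size bs + 2 * sumn gs <= n ->
  ball (overgroup_gens omega012) n (run_aut bs gs).
Proof.
move=> sz le; exists (run_word bs gs); split=> //.
  exact: leq_trans (run_word_size sz) le.
have Sd b s : s \in dstep_word b -> overgroup_gens omega012 s.
  by case: b => //; rewrite inE => /eqP ->; do 4 left; right.
elim: bs gs {sz le} => [|b bs IH] [|g gs] //= s; first exact: Sd.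
rewrite !mem_cat => /or3P[/IH //| |/Sd //].
elim: g => //= g IHg; rewrite !inE => /or3P[/eqP->|/eqP->|/IHg //].
  by do 7 left.
by do 3 left; right.
Qed.

(** Markov's inequality: at least half of the bit sequences have at most twice the average number of
    collisions. *)
Lemma few_collisions N C gs :
  2 * (\sum_(bs <- words bool N) collisions bs gs) <= C * 2 ^ N ->
  2 ^ N <= 2 * count (fun bs => collisions bs gs <= C) (words bool N).
Proof.
set good := count _ _ => le.
have := count_predC (fun bs => collisions bs gs <= C) (words bool N).
rewrite size_words card_bool -/good; set bad := count _ _ => gb.
have bad_le : bad * C.+1 <= \sum_(bs <- words bool N) collisions bs gs.
  rewrite /bad -sum1_count big_distrl /=.
  rewrite [X in _ <= X](bigID (fun bs => collisions bs gs <= C)) /=.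
  apply: leq_trans (leq_addl _ _); apply: leq_sum => bs.
  by rewrite mul1n ltnNge.
suff : 2 * bad <= 2 ^ N by lia.
rewrite leqNgt; apply/negP => lt.
have := leq_trans (leq_mul (leqnn 2) bad_le) le.
by rewrite leqNgt mulnA (leq_ltn_trans _ (ltn_mul lt (ltnSn C))) // mulnC.
Qed.

Lemma pow10_le R : 10 ^ (16 * R) <= 2 ^ (54 * R).
Proof.
have thousand : 10 ^ 3 <= 2 ^ 10 by [].
elim: R => [|R IH]; first by rewrite !muln0.
have -> : 16 * R.+1 = 1 + 3 * 5 + 16 * R by lia.
have -> : 54 * R.+1 = 4 + 10 * 5 + 54 * R by lia.
rewrite 4!expnD (expnM 10 3) (expnM 2 10).
apply: leq_mul; last exact: IH.
by apply: leq_mul; [by [] | rewrite leq_exp2r].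
Qed.

(** As M >= 8 K, half of the bit sequences of length N = 16 R have at most R collisions. Each is
    determined by its group element and its advice; by [count_sparse_words] with weight 8 there are
    at most 8^R (10/8)^N advice words. By [pow10_le] this gives 2^(64 R) <= 2 * [gamma_overgroup] *
    2^(57 R). *)
Lemma growth_lower M K : 8 * K <= M -> 4 <= K ->
  2 ^ 2 ^ (K - 4) <= gamma_overgroup (2 ^ K + 2 * (K * M * 2 ^ K)).
Proof.
move=> KM K4; have M0 : 0 < M by apply: leq_trans KM; lia.
set N := 2 ^ K; set R := 2 ^ (K - 4).
have NR : N = 16 * R by rewrite /N /R -{1}(subnKC K4) expnD.
have [gs [sz sum_gs coll]] := gaps_exist K M0; rewrite -/N in sz sum_gs coll.
set n := N + _; set X := (overgroup omega012 `&` ball (overgroup_gens omega012) n)%classic.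
have finX : finite_set X.
  by apply: sub_finite_set (finite_ball n overgroup_gens_finite) => g [].
pose good := [seq bs <- words bool N | collisions bs gs <= R].
pose advs := [seq a <- words (option bool) N | count (predC1 None) a <= R].
have size_good : 2 ^ N <= 2 * size good.
  rewrite size_filter; apply: few_collisions.
  have M8 : 32 * K * (\sum_(bs <- words bool N) collisions bs gs) <= K * N * 2 ^ N.
    by apply: leq_trans coll; rewrite leq_mul2r; apply/orP; right; lia.
  have K0 : 0 < K by lia.
  rewrite -(leq_pmul2l (_ : 0 < 16 * K)); last by rewrite muln_gt0.
  apply: leq_trans (_ : _ <= 32 * K * (\sum_(bs <- words bool N) collisions bs gs)) _.
    by apply: eq_leq; ring.
  by apply: leq_trans M8 _; rewrite NR; apply: eq_leq; ring.
have size_adv : size advs * 8 ^ N <= 8 ^ R * 10 ^ N.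
  have := count_sparse_words (None : option bool) R N (isT : 0 < 8).
  by rewrite card_option card_bool size_filter.
pose P bs (c : tree_aut * seq (option bool)) :=
  [/\ size bs = (size gs).+1, c.1 = run_aut bs gs & c.2 = advice bs gs].
have : size good <= gamma_overgroup n * size advs.
  rewrite -(size_allpairs pair (fset_set X)).
  apply: (size_le_codes (P := P)); first by rewrite filter_uniq ?words_uniq.
    move=> bs; rewrite mem_filter mem_words => /andP[few /eqP szN].
    have szg : size bs = (size gs).+1 by rewrite sz.
    exists (run_aut bs gs, advice bs gs); last by [].
    apply: allpairs_f.
      have in_ball : ball (overgroup_gens omega012) n (run_aut bs gs).
        by apply: run_aut_ball; rewrite // szN leq_add2l leq_mul2l.
      rewrite in_fset_set //; apply: mem_set; split=> //.
      exact: ball_overgroup in_ball.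
    rewrite mem_filter mem_words size_advice // szN eqxx andbT.
    exact: leq_trans (count_advice _ _) few.
  move=> bs bs' [g a] [sz1 /= -> ->] [sz2 /= gE aE].
  by apply: (run_inj sz1 sz2 aE); apply: run_aut_inj.
set G := gamma_overgroup n => le.
have R0 : 0 < R by rewrite expn_gt0.
have : 2 ^ N * 8 ^ N <= 2 * G * (8 ^ R * 10 ^ N).
  apply: leq_trans (leq_mul size_good (leqnn _)) _.
  rewrite -!mulnA leq_mul2l /=.
  apply: leq_trans (leq_mul le (leqnn _)) _.
  by rewrite -mulnA leq_mul2l size_adv orbT.
rewrite NR => le2; have := leq_trans le2 (leq_mul (leqnn _) (leq_mul (leqnn _) (pow10_le R))).
rewrite -[8]/(2 ^ 3) -!expnM -!expnD => le3.
have : 2 ^ (R.+1 + (3 * R + 54 * R)) <= 2 * G * 2 ^ (3 * R + 54 * R).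
  by apply: leq_trans le3; rewrite leq_exp2l //; lia.
by rewrite expnD leq_pmul2r ?expn_gt0 // expnS leq_pmul2l.
Qed.

Lemma gamma_overgroup_le m n :
  m <= n -> gamma_overgroup m <= gamma_overgroup n.
Proof.
move=> mn; set X := fun n =>
  (overgroup omega012 `&` ball (overgroup_gens omega012) n)%classic.
have finX i : finite_set (X i).
  by apply: sub_finite_set (finite_ball i overgroup_gens_finite) => g [].
apply: uniq_leq_size; first exact: fset_uniq.
move=> g; rewrite (in_fset_set (finX m)) (in_fset_set (finX n)).
move=> /set_mem[Og [w [sz Sw gE]]]; apply: mem_set; split=> //.
by exists w; split=> //; apply: leq_trans mn.
Qed.

(** Here [growth_lower] is used with K = l - 2 r and M = 8 * 2^r, where l is the integer part of
    log_2 n and 2^r lies between l and 2 l. The length is at most 17 n because K * 2^r * 2^K <= n,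
    and n < 2^(l+1) = 32 * 2^(2 r) * 2^(K-4) with 2^(2 r) <= 4 l^2 gives the constant 128. *)
Lemma growth_lower_log j n : 17 <= j -> 2 ^ j <= n -> exists l e,
  [/\ 2 ^ l <= n, n <= 128 * l ^ 2 * e & 2 ^ e <= gamma_overgroup (17 * n)].
Proof.
move=> j17 n_ge; have n0 : 0 < n by apply: leq_trans n_ge; rewrite expn_gt0.
set l := trunc_log 2 n; have /andP[ln nl] := trunc_log_bounds (isT : 1 < 2) n0.
rewrite -/l in ln nl.
have l17 : 17 <= l by apply: leq_trans j17 _; apply: trunc_log_max.
set r := up_log 2 l; have l1 : 1 < l by apply: leq_trans l17.
have /andP[rl lr] := up_log_bounds (isT : 1 < 2) l1; rewrite -/r in rl lr.
have r5 : 4 < r by rewrite -(ltn_exp2l _ _ (isT : 1 < 2)); apply: leq_trans lr.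
have r_le : 2 * r + 4 <= l.
  have pow2 i : 2 * (i + 5) + 4 <= 2 ^ (i + 4).
    by elim: i => // i IH; rewrite [i.+1 + 4]addSn expnS; lia.
  apply: leq_trans (ltnW rl); have := pow2 (r - 5).
  by rewrite subnK // (_ : r - 5 + 4 = r.-1) //; lia.
set K := l - 2 * r; exists l, (2 ^ (K - 4)); split=> //.
  have l2r : 2 ^ r * 2 ^ r <= 4 * l ^ 2.
    have : 2 ^ r <= 2 * l.
      by rewrite -(prednK (ltnW (ltnW (ltnW (ltnW r5))))) expnS leq_mul2l ltnW.
    by move=> h; have := leq_mul h h; rewrite -(mulnn l); lia.
  have -> : 128 * l ^ 2 * 2 ^ (K - 4) = 32 * (4 * l ^ 2) * 2 ^ (K - 4) by lia.
  apply: leq_trans (_ : _ <= 2 ^ 5 * (2 ^ r * 2 ^ r) * 2 ^ (K - 4)) _; last first.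
    by apply: (leq_mul (leq_mul _ l2r) (leqnn _)).
  rewrite -!expnD; apply: leq_trans (ltnW nl) _.
  by rewrite leq_exp2l // /K; lia.
have Kr2 : K <= 2 ^ r by apply: leq_trans (leq_subr _ _) lr.
have KM : 8 * K <= 8 * 2 ^ r by rewrite leq_mul2l.
have K4 : 4 <= K by rewrite /K; lia.
apply: leq_trans (growth_lower KM K4) (gamma_overgroup_le _).
have Kr : 2 ^ r * 2 ^ r * 2 ^ K <= n.
  by apply: leq_trans ln; rewrite -!expnD leq_exp2l // /K; lia.
have r0 : 0 < 2 ^ r by rewrite expn_gt0.
move: r0 Kr2 Kr; move: (2 ^ r) (2 ^ K) => a b a0 Ka ab.
have : b <= a * a * b by rewrite leq_pmull // muln_gt0 a0.
have : K * a * b <= a * a * b by rewrite !leq_mul2r Ka !orbT.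
by lia.
Qed.

(** * Asymptotics *)

Section Asymptotics.
Variable R : realType.
Local Open Scope ring_scope.
Implicit Types (n k : nat) (eps : R).

Lemma expR1_ge2 : 2 <= expR 1 :> R.
Proof. by apply: le_trans (expR_ge1Dx 1); lra. Qed.

Lemma expR1_le4 : expR 1 <= 4 :> R.
Proof.
have h : 2^-1 <= expR (- 2^-1) :> R by apply: le_trans (expR_ge1Dx _); lra.
have e0 := expR_gt0 (2^-1 : R).
have : expR 2^-1 <= 2 :> R by rewrite -lef_pV2 ?posrE // -expRN.
rewrite [X in expR X <= 4](_ : 1 = 2^-1 + 2^-1 :> R); last by lra.
by rewrite expRD; nra.
Qed.

Lemma expn_le_expR n : 2 ^+ n <= expR n%:R :> R.
Proof.
rewrite -[n%:R]mulr1 expRM_natl lerXn2r ?nnegrE ?expR_ge0 //.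
exact: expR1_ge2.
Qed.

Lemma expR_le_expn n : expR n%:R <= 4 ^+ n :> R.
Proof.
rewrite -[n%:R]mulr1 expRM_natl lerXn2r ?nnegrE ?expR_ge0 //.
exact: expR1_le4.
Qed.

Lemma preceq_growth_lower eps : 0 < eps ->
  preceq_growth (fun n => expR (n%:R / exp.ln n%:R `^ (2 + eps))) gamma_overgroup.
Proof.
move=> eps0; set c : R := exp.ln 2.
have c0 : 0 < c by rewrite ln_gt0 // ltr1n.
(* From n <= 128 l^2 e and c l <= ln n follows n <= C (ln n)^2 c e; for large n the factor (ln
   n)^eps absorbs C. *)
set C := 128 / c ^+ 3; have C0 : 0 < C by rewrite divr_gt0 // exprn_gt0.
have [N hN] : exists N : nat, expR (C `^ eps^-1) <= N%:R.
  by exists (Num.bound (expR (C `^ eps^-1))); apply/ltW/archi_boundP/expR_ge0.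
have [j j17] : exists j, (17 <= j)%N by exists 17%N.
exists 1, 17%N; split=> //; exists (maxn N (2 ^ j))%N => // n /=.
rewrite geq_max => /andP[Nn /(growth_lower_log j17)[l [e [ln nl le]]]].
rewrite mul1r; apply: le_trans (_ : (2 ^ e)%:R <= _); last by rewrite ler_nat.
have n0 : 0 < n%:R :> R by rewrite ltr0n (leq_trans _ ln) // expn_gt0.
have lnl : l%:R * c <= exp.ln n%:R.
  by rewrite mulr_natl -lnXn // ler_ln ?posrE ?exprn_gt0 // -natrX ler_nat.
have big : C `^ eps^-1 <= exp.ln n%:R.
  rewrite -[leLHS]expRK ler_ln ?posrE ?expR_gt0 //.
  by apply: le_trans hN _; rewrite ler_nat.
have L0 : 0 < exp.ln n%:R :> R by apply: lt_le_trans big; apply: powR_gt0.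
have CL : C <= exp.ln n%:R `^ eps.
  have -> : C = (C `^ eps^-1) `^ eps.
    by rewrite -powRrM mulVf ?lt0r_neq0 // powRr1 // ltW.
  apply: ge0_ler_powR; rewrite ?nnegrE ?powR_ge0 //; exact: ltW.
have -> : (2 ^ e)%:R = expR (e%:R * c) :> R by rewrite expRM_natl lnK ?posrE // natrX.
rewrite ler_expR.
rewrite powRD; last by rewrite (gt_eqF L0) implybT.
rewrite powR_mulrn ?(ltW L0) // ler_pdivrMr ?mulr_gt0 ?exprn_gt0 ?powR_gt0 //.
apply: le_trans (_ : 128 * l%:R ^+ 2 * e%:R <= _).
  by rewrite -natrX -!natrM ler_nat.
have -> : 128 * l%:R ^+ 2 * e%:R = e%:R * c * ((l%:R * c) ^+ 2 * C) :> R.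
  by rewrite /C; field; exact: lt0r_neq0.
have lc0 : 0 <= l%:R * c by rewrite mulr_ge0 // ltW.
apply: ler_wpM2l; first by rewrite mulr_ge0 // ltW.
apply: ler_pM; [exact: exprn_ge0 | exact: ltW | | exact: CL].
by apply: lerXn2r; rewrite ?nnegrE // ltW.
Qed.

(** After k^(5 n) is cancelled, the factors in [growth_upper] cost F, F, 7 F, 15 F and 75 F in the
    exponent; a spare F completes 100 F. *)
Lemma growth_upper_expR (k n : nat) : (0 < k)%N -> (k * 2 ^ k <= n)%N ->
    (n <= 4 * 4 ^ k)%N -> 1 <= exp.ln k%:R :> R ->
  (gamma_overgroup n)%:R <= expR (100 * (n%:R / k%:R * exp.ln k%:R)) :> R.
Proof.
move=> k0 kn nk lnk; have := growth_upper k0 kn.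
set E : R := n%:R / k%:R; set F := E * _; set r := (15 * n %/ k)%N => le.
have k0R : 0 < k%:R :> R by rewrite ltr0n.
have E0 : 0 <= E by rewrite divr_ge0.
have EF : E <= F by rewrite ler_peMr.
have powE : 2 ^+ k <= E.
  by rewrite ler_pdivlMr // -natrX -natrM ler_nat mulnC.
have k2 : k%:R <= 2 ^+ k :> R by rewrite -natrX ler_nat ltnW // ltn_expl.
have kF : k%:R <= F by apply: le_trans k2 (le_trans powE EF).
have kE : k%:R <= expR F.
  apply: le_trans (_ : expR k%:R <= _); last by rewrite ler_expR.
  by apply: le_trans (expR_ge1Dx _); rewrite lerDr.
have wE : 2 ^+ (2 ^ k) <= expR F.
  apply: le_trans (expn_le_expR _) _; rewrite ler_expR natrX.
  exact: le_trans EF.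
have nE : (5 * n).+1%:R <= expR (7 * F).
  apply: le_trans (_ : expR (7 * k)%:R <= _); last first.
    by rewrite ler_expR natrM ler_pM2l.
  apply: le_trans (expn_le_expR _); rewrite -natrX ler_nat.
  apply: leq_trans (_ : 2 ^ 5 * 2 ^ (2 * k) <= _)%N.
    have n0 : (0 < n)%N by apply: leq_trans kn; rewrite muln_gt0 k0 expn_gt0.
    rewrite expnM; apply: (@leq_trans (32 * 4 ^ k)); last exact: leqnn.
    by move: nk; move: (4 ^ k)%N => p; lia.
  by rewrite -expnD leq_exp2l //; lia.
have rE : k%:R ^+ r <= expR (15 * F).
  rewrite -[X in X ^+ r](@lnK R) ?posrE // -expRM_natl ler_expR /F mulrA.
  rewrite ler_wpM2r ?(le_trans ler01) // /E mulrA ler_pdivlMr //.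
  by rewrite -!natrM ler_nat leq_divM.
(* With q = 15 / k one has k + 15 = k (1 + q) <= k exp q, and 5 n q = 75 E. *)
have sE : (k + 15)%:R ^+ (5 * n) <= k%:R ^+ (5 * n) * expR (75 * F).
  have [q kq] : exists q : R, k%:R * q = 15%:R.
    by exists (k%:R^-1 * 15%:R); rewrite mulVKf ?lt0r_neq0.
  have nE' : n%:R = E * k%:R by rewrite /E mulfVK ?lt0r_neq0.
  apply: le_trans (_ : (k%:R * expR q) ^+ (5 * n) <= _).
    apply: lerXn2r.
    - by rewrite nnegrE; apply: ler0n.
    - by rewrite nnegrE; apply: mulr_ge0; [exact: ltW | exact: expR_ge0].
    rewrite natrD -kq -[X in X + _]mulr1 -mulrDr.
    by apply: ler_wpM2l; [exact: ltW | exact: expR_ge1Dx].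
  rewrite exprMn -expRM_natl ler_pM2l ?exprn_gt0 // ler_expR.
  have -> : (5 * n)%:R * q = 75 * E.
    rewrite natrM nE' (_ : _ * q = 5%:R * E * (k%:R * q)); last by ring.
    by rewrite kq; ring.
  by rewrite ler_pM2l.
have kn0 : 0 < k%:R ^+ (5 * n) :> R by rewrite exprn_gt0.
rewrite -(ler_pM2r kn0) -natrX -natrM.
apply: le_trans (_ : _ <= _%:R) _; first by rewrite ler_nat; exact: le.
rewrite !natrM !natrX.
rewrite (_ : 100 * F = F + F + 7 * F + (15 * F + 75 * F) + F); last by lra.
rewrite 5!expRD; have F1 : 1 <= expR F by rewrite -expR0 ler_expR (le_trans E0).
rewrite [leRHS](_ : _ = expR F * expR F * expR (7 * F) * (expR (15 * F) *
  (k%:R ^+ (5 * n) * expR (75 * F))) * expR F); last by ring.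
rewrite -[leLHS]mulr1; apply: ler_pM => //.
by do !(apply: ler_pM; rewrite ?mulr_ge0 ?exprn_ge0 //).
Qed.

Lemma preceq_growth_upper :
  preceq (fun n => (gamma_overgroup n)%:R)
    (fun t : R => expR (t * exp.ln (exp.ln t) / exp.ln t)).
Proof.
(* The 100 comes from [growth_upper_expR]; the 8 is 4 from ln n <= 4 k times 2 from ln (B n) <= 2 ln
   n. The bound 2^9 yields k >= 4, hence ln k >= 1. *)
have [B [c [B9 c0 cE BE]]] : exists B (c : R),
    [/\ (2 ^ 9 <= B)%N, 0 <= c, 100 = c & B%:R = 8 * c].
  exists (8 * 100)%N, 100%:R; split; rewrite ?natrM //; exact: ler0n.
have B0 : 0 < B%:R :> R by rewrite ltr0n; apply: leq_trans B9.
exists 1, B%:R; split=> //; exists B => // n /= nB.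
rewrite mul1r; have n0 : (0 < n)%N by apply: leq_trans nB; apply: leq_trans B9.
have /andP[ln_n n_ln] := trunc_log_bounds (isT : (1 < 2)%N) n0.
(* Half of the logarithm, so that k * 2^k <= 4^k <= n and the 2^k root actions cost at most n / k
   bits. *)
set l := trunc_log 2 n in ln_n n_ln; set k := l./2.
have l2k : (2 * k <= l <= (2 * k).+1)%N by rewrite /k; lia.
have l9 : (9 <= l)%N by apply: trunc_log_max; rewrite // (leq_trans B9 nB).
have k4 : (4 <= k)%N by lia.
have k0 : (0 < k)%N by apply: leq_trans k4.
have n4k : (4 ^ k <= n)%N.
  by apply: leq_trans ln_n; rewrite -[4%N]/(2 ^ 2)%N -expnM leq_exp2l //; lia.
have nk : (n <= 4 * 4 ^ k)%N.
  apply: leq_trans (ltnW n_ln) _.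
  by rewrite -expnS -[4%N]/(2 ^ 2)%N -expnM leq_exp2l //; lia.
have kn : (k * 2 ^ k <= n)%N.
  apply: leq_trans n4k; rewrite -[4%N]/(2 * 2)%N expnMn leq_mul2r.
  by rewrite (ltnW (ltn_expl k _)) ?orbT.
have nR : 0 < n%:R :> R by rewrite ltr0n.
have kR : 0 < k%:R :> R by rewrite ltr0n.
have lnk : 1 <= exp.ln k%:R :> R.
  rewrite -[leLHS]expRK ler_ln ?posrE ?expR_gt0 //.
  by apply: le_trans expR1_le4 _; rewrite ler_nat.
apply: le_trans (growth_upper_expR k0 kn nk lnk) _; rewrite ler_expR.
set L := exp.ln n%:R : R.
have kL : k%:R <= L.
  rewrite -[leLHS]expRK ler_ln ?posrE ?expR_gt0 //.
  by apply: le_trans (expR_le_expn _) _; rewrite -natrX ler_nat.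
have L4 : L <= 4 * k%:R.
  rewrite -[leRHS]expRK -natrM ler_ln ?posrE ?expR_gt0 //.
  apply: le_trans (expn_le_expR _); rewrite -natrX ler_nat.
  apply: leq_trans nk _; rewrite -expnS -[4%N in leqLHS]/(2 ^ 2)%N -expnM.
  by rewrite leq_exp2l //; lia.
have L0 : 0 < L by apply: lt_le_trans kL.
have lnL : exp.ln k%:R <= exp.ln L by rewrite ler_ln ?posrE.
have lnt : exp.ln (B%:R * n%:R) = exp.ln B%:R + L by rewrite lnM ?posrE.
have lnB : 0 <= exp.ln B%:R :> R.
  by apply: ln_ge0; rewrite ler1n; apply: leq_trans B9.
have lnBL : exp.ln B%:R <= L by rewrite ler_ln ?posrE // ler_nat.
have lnt2 : L <= exp.ln (B%:R * n%:R) <= 2 * L by rewrite lnt; apply/andP; split; lra.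
set T := exp.ln (B%:R * n%:R) in lnt2 *.
have [LT TL] := andP lnt2; have T0 : 0 < T by apply: lt_le_trans LT.
have lnT : exp.ln L <= exp.ln T by rewrite ler_ln ?posrE.
have lnL0 : 0 <= exp.ln L by apply: le_trans lnL; apply: le_trans lnk.
have lnk0 : 0 <= exp.ln k%:R :> R by apply: le_trans lnk.
have cn0 : 0 <= c * n%:R by apply: mulr_ge0 c0 (ltW nR).
rewrite cE BE; apply: le_trans (_ : c * n%:R * exp.ln L * 4 / L <= _).
  rewrite ler_pdivlMr //.
  have -> : c * (n%:R / k%:R * exp.ln k%:R) * L =
      c * n%:R * exp.ln k%:R * (L / k%:R) by ring.
  apply: ler_pM; [exact: mulr_ge0 | exact: divr_ge0 (ltW L0) (ltW kR) | |].
    exact: ler_wpM2l.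
  by rewrite ler_pdivrMr.
rewrite ler_pdivlMr // mulrAC ler_pdivrMr //.
have -> : 8 * c * n%:R * exp.ln T * L = c * n%:R * exp.ln T * 4 * (2 * L) by ring.
have lnT0 : 0 <= exp.ln T := le_trans lnL0 lnT.
apply: ler_pM; [| exact: ltW | | exact: TL].
  by apply: mulr_ge0 => //; apply: mulr_ge0.
by apply: ler_wpM2r => //; apply: ler_wpM2l.
Qed.

End Asymptotics.

Local Open Scope ring_scope.

Theorem mainTheorem4 (R : realType) (eps : R) (eps_gt0 : 0 < eps) :
  preceq_growth (fun n : nat => expR (n%:R / ln n%:R `^ (2 + eps)))
    gamma_overgroup /\
  preceq (fun n : nat => (gamma_overgroup n)%:R)
    (fun t : R => expR (t * ln (ln t) / ln t)).
Proof.
by split; [exact: preceq_growth_lower | exact: preceq_growth_upper].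
Qed.
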